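(* Let $\mathfrak s$ be a semisimple Lie algebra over $\mathbb K\in\{\mathbb R,\mathbb C\}$ such that the dimension of the generic coadjoint orbit of $\mathfrak s$ is greater than or equal to $6$, and let $\pi_1$ be the Lie–Poisson bivector on $\mathfrak s^*$. Let $X$ be a quadratic vector field and $q$ a homogeneous quadratic polynomial on $\mathfrak s^*$, and put $\pi=[X,\pi_1]$. If $$[\pi,\pi]=2\,\pi_1(q)\wedge\pi_1,$$ then $$[\pi,\pi_1(q)]=0.$$
   Context: A vector field is quadratic if its coefficients in linear coordinates are homogeneous quadratic polynomials. $[\cdot,\cdot]$ is the Schouten bracket, normalized by $[X,f]=Xf$, $[X,Y]$ the Lie bracket for vector fields, $[P,Q]=-(-1)^{(p-1)(q-1)}[Q,P]$, $[P,Q\wedge R]=[P,Q]\wedge R+(-1)^{(p-1)q}Q\wedge[P,R]$ for $P,Q$ of degrees $p,q$. For a bivector $\eta$ and a function $f$, $\eta(f):=[\eta,f]$ (contraction of $\eta$ with $df$ over the second index). The Lie–Poisson bivector satisfies $\{x,y\}_{\pi_1}=[x,y]$ for $x,y\in\mathfrak s$ regarded as linear functions on $\mathfrak s^*$. The dimension of the generic coadjoint orbit means the maximal rank of $\pi_1$ (real dimension for $\mathbb K=\mathbb R$, complex dimension for $\mathbb K=\mathbb C$). *)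

(* Defs.v *)
From HB Require Import structures.
From mathcomp Require Import all_boot all_order all_algebra.
From mathcomp Require Import reals.
From mathcomp Require Import complex.
From mathcomp Require Import mpoly.
From mathcomp Require Import ring zify.
From mathcomp Require boolp.

Set Implicit Arguments.
Unset Strict Implicit.
Unset Printing Implicit Defensive.

Import GRing.Theory.
Local Open Scope ring_scope.

Variant scalar_kind := RealScalars | ComplexScalars.

Definition scalars (R : realType) (k : scalar_kind) : fieldType :=
  match k with
  | RealScalars => R : fieldType
  | ComplexScalars => R[i] : fieldType
  end.

Section LieAlgebra.
Variables (K : fieldType) (L : vectType K) (br : L -> L -> L).

Record is_lie_bracket : Prop := IsLieBracket {
  lie_linear_l : forall y : L, linear (fun x => br x y);
  lie_linear_r : forall x : L, linear (br x);
  lie_alternating : forall x : L, br x x = 0;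
  lie_jacobi : forall x y z : L,
    br x (br y z) + br y (br z x) + br z (br x y) = 0 }.

Definition lie_ideal (I : {vspace L}) : Prop :=
  forall x y : L, y \in I -> br x y \in I.

(* By bilinearity, the brackets of basis vectors already span [U, U]. *)
Definition lie_derived (U : {vspace L}) : {vspace L} :=
  <<[seq br x y | x <- vbasis U, y <- vbasis U]>>%VS.

Definition lie_solvable (U : {vspace L}) : Prop :=
  exists m : nat, iter m lie_derived U = 0%VS.

Definition semisimple : Prop :=
  forall I : {vspace L}, lie_ideal I -> lie_solvable I -> I = 0%VS.

End LieAlgebra.

(* Multivector fields on K^n with polynomial coefficients: P S is the
   coefficient of d_{i_1} /\ ... /\ d_{i_p}, where S = {i_1 < ... < i_p} and
   d_i is the i-th coordinate vector field. *)
Notation multivector K n := {ffun {set 'I_n} -> {mpoly K[n]}}.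

Section Multivectors.
Variables (K : fieldType) (n : nat).
Implicit Types (P Q X : multivector K n) (f : {mpoly K[n]}) (i j : 'I_n)
  (A B S : {set 'I_n}).

(* d_A /\ d_B = shuffle_sign A B *: d_(A :|: B) for disjoint A and B. *)
Definition shuffle_sign A B : {mpoly K[n]} :=
  (-1) ^+ #|[set ab : 'I_n * 'I_n | [&& ab.1 \in A, ab.2 \in B & (ab.2 < ab.1)%N]]|.

Definition wedge P Q : multivector K n :=
  [ffun S : {set 'I_n} => \sum_(A : {set 'I_n} | A \subset S)
     shuffle_sign A (S :\: A) * P A * Q (S :\: A)].

Definition mv_fun f : multivector K n := [ffun S : {set 'I_n} => if S == set0 then f else 0].

Definition coord_vf i : multivector K n := [ffun S : {set 'I_n} => (S == [set i])%:R].

Definition mv_degree (p : nat) P : Prop := forall S, #|S| != p -> P S = 0.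

Definition quadratic_vector_field X : Prop :=
  mv_degree 1 X /\ forall i, X [set i] \is 2.-homog.

Definition mv_deriv i P : multivector K n := [ffun S : {set 'I_n} => (P S)^`M(i)].

(* Left and right derivatives with respect to the odd generator d_i:
   contraction with dx_i in the first, resp. last, slot. *)
Definition contract_l i P : multivector K n :=
  [ffun S : {set 'I_n} => if i \in S then 0 else shuffle_sign [set i] S * P (i |: S)].

Definition contract_r i P : multivector K n :=
  [ffun S : {set 'I_n} => if i \in S then 0 else shuffle_sign S [set i] * P (i |: S)].

(* The coordinate formula for the Schouten bracket normalized by [X, f] = X f,
   [X, Y] = Lie bracket, [P, Q] = -(-1)^((p-1)(q-1)) [Q, P] and
   [P, Q /\ R] = [P, Q] /\ R + (-1)^((p-1)q) Q /\ [P, R]: see schouten_vf_fun,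
   schouten_vf_vf, schouten_antisym and schouten_wedge below. *)
Definition schouten P Q : multivector K n :=
  \sum_(i < n) (wedge (contract_r i P) (mv_deriv i Q)
                - wedge (mv_deriv i P) (contract_l i Q)).

(* P(f) := [P, f]; for a bivector P, this contracts df with the second index. *)
Definition hamiltonian P f : multivector K n := schouten P (mv_fun f).

Definition bivector_mx P (x : 'I_n -> K) : 'M[K]_n :=
  \matrix_(i, j) if (i < j)%N then (P [set i; j]).@[x]
                 else if (j < i)%N then - (P [set i; j]).@[x] else 0.

(* The maximum over the points x of K^n of the rank of P at x. *)
Definition max_rank P : nat :=
  \max_(r < n.+1 | boolp.asbool (exists x, \rank (bivector_mx P x) = r)) r.

End Multivectors.

Section LiePoisson.
Variables (K : fieldType) (L : vectType K) (br : L -> L -> L).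
Variables (n : nat) (e : n.-tuple L).

(* x in L as a linear function on the dual of L; the coordinates on the dual
   attached to the basis e are 'X_i = e_i. *)
Definition linear_fun (x : L) : {mpoly K[n]} := \sum_(i < n) coord e i x *: 'X_i.

Definition lie_poisson : multivector K n :=
  \sum_(i < n) \sum_(j < n | (i < j)%N)
    wedge (mv_fun (linear_fun (br (tnth e i) (tnth e j))))
          (wedge (coord_vf K i) (coord_vf K j)).

Definition generic_coadjoint_orbit_dim : nat := max_rank lie_poisson.

End LiePoisson.

Section SchoutenNormalization.
Variables (K : fieldType) (n : nat).
Implicit Types (P Q R X Y : multivector K n) (f : {mpoly K[n]}) (i j : 'I_n)
  (A B C S : {set 'I_n}) (p q r : nat).

Let sg A B := shuffle_sign K A B.

Lemma shuffle_signE A B :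
  shuffle_sign K A B = \prod_(a in A) \prod_(b in B) (-1) ^+ (b < a)%N.
Proof.
rewrite pair_big_dep /= /shuffle_sign -sum1_card prodrXr; congr (_ ^+ _).
rewrite [RHS](bigID (fun ab : 'I_n * 'I_n => (ab.2 < ab.1)%N)) /=.
rewrite [X in _ = (_ + X)%N]big1 ?addn0; last by move=> [a b] /= /andP[_ /negbTE->].
rewrite [RHS](eq_bigr (fun=> 1%N)); last by move=> [a b] /= /andP[_ ->].
by apply: eq_bigl => -[a b]; rewrite inE /= -andbA.
Qed.

Lemma shuffle_signUl A B C : [disjoint A & B] -> sg (A :|: B) C = sg A C * sg B C.
Proof.
move=> dAB; rewrite /sg !shuffle_signE -bigU //=.
by apply: eq_bigl => a; rewrite !inE.
Qed.

Lemma shuffle_signUr A B C : [disjoint B & C] -> sg A (B :|: C) = sg A B * sg A C.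
Proof.
move=> dBC; rewrite /sg !shuffle_signE -big_split /=.
apply: eq_bigr => a _; rewrite -bigU //=.
by apply: eq_bigl => b; rewrite !inE.
Qed.

Lemma shuffle_sign_sqr A B : sg A B * sg A B = 1.
Proof. by rewrite /sg /shuffle_sign -expr2 sqrr_sign. Qed.

Lemma shuffle_signC A B : [disjoint A & B] ->
  sg A B * sg B A = (-1) ^+ (#|A| * #|B|).
Proof.
move=> dAB; rewrite /sg !shuffle_signE [X in _ * X]exchange_big -big_split /=.
transitivity (\prod_(a in A) \prod_(b in B) (-1 : {mpoly K[n]})); last first.
  by rewrite !prodr_const -exprM mulnC.
apply: eq_bigr => a aA; rewrite -big_split /=; apply: eq_bigr => b bB.
have : val a != val b.
  by apply: contraTneq bB => /val_inj <-; rewrite (disjointFr dAB).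
by rewrite neq_ltn; case: ltngtP => //= _ _; rewrite ?mulr1 ?mul1r.
Qed.

Lemma setUDK A S : A \subset S -> A :|: S :\: A = S.
Proof. by move=> /setIidPr AS; rewrite -{1}AS setID. Qed.

Lemma disjointD A S : [disjoint A & S :\: A].
Proof.
by rewrite -setI_eq0 setIDA setDE -setIA setIC -setIA [~: A :&: _]setIC setICr setI0.
Qed.

Lemma wedge_reindex (F : {set 'I_n} -> {mpoly K[n]}) S :
  \sum_(A : {set 'I_n} | A \subset S) F (S :\: A)
  = \sum_(A : {set 'I_n} | A \subset S) F A.
Proof.
rewrite [RHS](reindex_onto (fun A => S :\: A) (fun A => S :\: A)) /=; last first.
  by move=> A /setIidPr AS; rewrite setDDr setDv set0U.
apply: eq_bigl => A; rewrite subsetDl /= setDDr setDv set0U.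
by apply/idP/eqP => [/setIidPr|/setIidPr].
Qed.

Lemma sum_subsetU1 (F : {set 'I_n} -> {mpoly K[n]}) i S : i \notin S ->
  \sum_(A : {set 'I_n} | A \subset i |: S) F A
  = \sum_(A : {set 'I_n} | A \subset S) F (i |: A)
    + \sum_(A : {set 'I_n} | A \subset S) F A.
Proof.
move=> iS; rewrite (bigID (fun A : {set 'I_n} => i \in A)) /=; congr (_ + _).
  rewrite (reindex_onto (fun A => i |: A) (fun A => A :\ i)) /=; last first.
    by move=> A /andP[_ iA]; rewrite setD1K.
  apply: eq_bigl => A; rewrite setU11 andbT; apply/andP/idP => [[sA /eqP <-]|AS].
    by rewrite subDset.
  rewrite setUS // setU1K ?eqxx //; exact: contra (subsetP AS i) iS.
apply: eq_bigl => A; apply/andP/idP => [[AS iA]|AS].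
  apply/subsetP => a aA; have /setU1P[ai|//] := subsetP AS a aA.
  by rewrite -ai aA in iA.
split; first exact: subset_trans AS (subsetUr _ _).
exact: contra (subsetP AS i) iS.
Qed.

Lemma sign_double p q : (-1 : K) ^+ (p.*2 + q) = (-1) ^+ q.
Proof. by rewrite exprD -(signr_odd _ p.*2) odd_double mul1r. Qed.

Lemma wedgeDl P Q R : wedge (P + Q) R = wedge P R + wedge Q R.
Proof.
apply/ffunP => S; rewrite !ffunE -big_split; apply: eq_bigr => A _ /=.
by rewrite ffunE mulrDr mulrDl.
Qed.

Lemma wedgeDr P Q R : wedge R (P + Q) = wedge R P + wedge R Q.
Proof.
apply/ffunP => S; rewrite !ffunE -big_split; apply: eq_bigr => A _ /=.
by rewrite ffunE mulrDr.
Qed.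

Lemma wedgeZl (c : K) P Q : wedge (c *: P) Q = c *: wedge P Q.
Proof.
apply/ffunP => S; rewrite !ffunE scaler_sumr; apply: eq_bigr => A _ /=.
by rewrite ffunE -scalerAr -scalerAl.
Qed.

Lemma wedgeZr (c : K) P Q : wedge P (c *: Q) = c *: wedge P Q.
Proof.
apply/ffunP => S; rewrite !ffunE scaler_sumr; apply: eq_bigr => A _ /=.
by rewrite ffunE -scalerAr.
Qed.

Lemma wedgeNr P Q : wedge P (- Q) = - wedge P Q.
Proof. by rewrite -scaleN1r wedgeZr scaleN1r. Qed.

Lemma wedgeNl P Q : wedge (- P) Q = - wedge P Q.
Proof. by rewrite -scaleN1r wedgeZl scaleN1r. Qed.

Lemma wedge0r P : wedge P 0 = 0.
Proof. by rewrite -{1}(scale0r (0 : multivector K n)) wedgeZr scale0r. Qed.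

Lemma wedge0l P : wedge 0 P = 0.
Proof. by rewrite -{1}(scale0r (0 : multivector K n)) wedgeZl scale0r. Qed.

Lemma wedge_suml (I : finType) (F : I -> multivector K n) Q :
  wedge (\sum_i F i) Q = \sum_i wedge (F i) Q.
Proof. exact: (big_morph _ (fun x y => wedgeDl x y Q) (wedge0l Q)). Qed.

Lemma wedge_sumr (I : finType) (F : I -> multivector K n) Q :
  wedge Q (\sum_i F i) = \sum_i wedge Q (F i).
Proof. exact: (big_morph _ (fun x y => wedgeDr x y Q) (wedge0r Q)). Qed.

Lemma wedgeA P Q R : wedge P (wedge Q R) = wedge (wedge P Q) R.
Proof.
apply/ffunP => S; rewrite !ffunE.
under eq_bigr do rewrite ffunE mulr_sumr.
under [RHS]eq_bigr do rewrite ffunE mulr_sumr mulr_suml.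
rewrite [RHS](exchange_big_dep (fun A : {set 'I_n} => A \subset S)) /=; last first.
  by move=> C A CS AC; apply: subset_trans CS.
apply: eq_bigr => A AS.
rewrite [RHS](reindex_onto (fun B => A :|: B) (fun C => C :\: A)) /=; last first.
  by move=> C /andP[_ AC]; rewrite setUDK.
have eqP' B : (A :|: B \subset S) && (A \subset A :|: B) && ((A :|: B) :\: A == B)
    = (B \subset S :\: A).
  rewrite subUset AS subsetUl andbT /= subsetD setDUl setDv set0U.
  by congr (_ && _); apply/eqP/idP => [/setDidPl|/setDidPl].
rewrite (eq_bigl _ _ eqP'); apply: eq_bigr => B.
move=> BS; have := BS; rewrite -eqP' => /andP[_ /eqP ->].
have dAB : [disjoint A & B] by apply: disjointWr BS (disjointD A S).
have eD : S :\: (A :|: B) = (S :\: A) :\: B by rewrite setDDl.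
have eS : S :\: A = B :|: (S :\: A) :\: B by rewrite setUDK.
rewrite eD -!/(sg _ _) (shuffle_signUl _ dAB) {1}eS.
by rewrite shuffle_signUr ?disjointD //; ring.
Qed.

Lemma wedgeC p q P Q : mv_degree p P -> mv_degree q Q ->
  wedge P Q = (-1) ^+ (p * q) *: wedge Q P.
Proof.
move=> dP dQ; apply/ffunP => S; rewrite !ffunE scaler_sumr.
rewrite -[LHS](wedge_reindex) /=; apply: eq_bigr => A AS.
have e : S :\: (S :\: A) = A by rewrite setDDr setDv set0U; apply/setIidPr.
rewrite e; have [cA|/dQ->] := eqVneq #|A| q; last by rewrite !(mulr0, mul0r) scaler0.
have [cB|/dP->] := eqVneq #|S :\: A| p; last by rewrite !(mulr0, mul0r) scaler0.
have := shuffle_signC (disjointD A S); rewrite cA cB mulnC => eS.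
have -> (x : {mpoly K[n]}) : (-1 : K) ^+ (p * q) *: x = (-1) ^+ (p * q) * x.
  by rewrite -mul_mpolyC rmorphXn rmorphN1.
rewrite -eS -!/(sg _ _).
by rewrite !mulrA (mulrAC (sg A _)) shuffle_sign_sqr mul1r mulrAC.
Qed.

Lemma mv_deriv_wedge i P Q :
  mv_deriv i (wedge P Q) = wedge (mv_deriv i P) Q + wedge P (mv_deriv i Q).
Proof.
apply/ffunP => S; rewrite !ffunE raddf_sum -big_split; apply: eq_bigr => A _ /=.
have sgK (B C : {set 'I_n}) : exists c : K, shuffle_sign K B C = c%:MP_[n].
  eexists ((-1) ^+ _); rewrite rmorphXn rmorphN1; reflexivity.
have [c ->] := sgK A (S :\: A).
by rewrite !ffunE -!mulrA !mul_mpolyC mderivZ mderivM scalerDr.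
Qed.

Lemma contract_l_wedge i q Q R : mv_degree q Q ->
  contract_l i (wedge Q R)
  = wedge (contract_l i Q) R + (-1) ^+ q *: wedge Q (contract_l i R).
Proof.
move=> dQ.
have signZ m (x : {mpoly K[n]}) : (-1 : K) ^+ m *: x = (-1) ^+ m * x.
  by rewrite -mul_mpolyC rmorphXn rmorphN1.
apply/ffunP => S; rewrite !ffunE signZ.
have dj (A : {set 'I_n}) : i \notin A -> [disjoint [set i] & A].
  by move=> iA; rewrite disjoints1.
case: ifPn => iS.
- have := setD1K iS; have iT : i \notin S :\ i by rewrite !inE eqxx.
  move: (S :\ i) iT => T iT eT; rewrite -{S iS}eT.
  rewrite !sum_subsetU1 // -!addrA.
  rewrite [X in _ = X + _]big1 => [|A AT]; last first.
    by rewrite ffunE setU11 mulr0 mul0r.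
  rewrite add0r [X in _ = _ + _ * (_ + X)]big1 => [|A AT]; last first.
    have iA : i \notin A by exact: contra (subsetP AT i) iT.
    by rewrite ffunE !inE eqxx iA /= !mulr0.
  rewrite addr0 mulr_sumr -big_split big1 //= => A AT.
  have iA : i \notin A by exact: contra (subsetP AT i) iT.
  have e1 : (i |: T) :\: A = i |: (T :\: A).
    rewrite setDUl; congr (_ :|: _); apply/setDidPl; exact: dj.
  have iB : i \notin T :\: A by rewrite !inE (negbTE iT) andbF.
  have e2 : (i |: T) :\: (i |: A) = T :\: A.
    apply/setP => x; rewrite !inE; case: eqVneq => //= ->.
    by rewrite (negbTE iT) andbF.
  rewrite e1 e2 !ffunE (negbTE iA) (negbTE iB).
  rewrite -!/(sg _ _) shuffle_signUr ?dj // shuffle_signUl ?dj //.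
  have [cA|/dQ->] := eqVneq #|i |: A| q; last by rewrite !(mulr0, mul0r) addr0.
  rewrite -cA cardsU1 iA exprS.
  have := shuffle_signC (dj _ iA); rewrite cards1 mul1n => eA; rewrite -eA.
  have := shuffle_sign_sqr [set i] (T :\: A).
  move: (sg [set i] _) (sg A [set i]) (sg A (_ :\: _)) (sg [set i] A) => a b c d ea.
  move: (Q _ : {mpoly K[n]}) (R _ : {mpoly K[n]}) => x y.
  rewrite (_ : _ + _ = (b * c * d * x * y) * (1 - a * a)); last by ring.
  by rewrite ea subrr mulr0.
- rewrite sum_subsetU1 // mulrDr !mulr_sumr; congr (_ + _); apply: eq_bigr => A AS.
  + have iA : i \notin A by exact: contra (subsetP AS i) iS.
    have iB : i \notin S :\: A by rewrite !inE (negbTE iS) andbF.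
    have e2 : (i |: S) :\: (i |: A) = S :\: A.
      apply/setP => x; rewrite !inE; case: eqVneq => //= ->.
      by rewrite (negbTE iS) andbF.
    have eS : S = A :|: (S :\: A) by rewrite setUDK.
    rewrite e2 !ffunE (negbTE iA) -!/(sg _ _) {1}eS.
    rewrite shuffle_signUr ?disjointD // shuffle_signUl ?dj //.
    have := shuffle_sign_sqr [set i] (S :\: A).
    move: (sg [set i] _) (sg A _) (sg [set i] A) => a c d ea.
    by rewrite -[RHS]mul1r -ea; ring.
  + have iA : i \notin A by exact: contra (subsetP AS i) iS.
    have iB : i \notin S :\: A by rewrite !inE (negbTE iS) andbF.
    have e1 : (i |: S) :\: A = i |: (S :\: A).
      rewrite setDUl; congr (_ :|: _); apply/setDidPl; exact: dj.
    have eS : S = A :|: (S :\: A) by rewrite setUDK.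
    rewrite e1 !ffunE (negbTE iB) -!/(sg _ _) {1}eS.
    rewrite shuffle_signUr ?disjointD // shuffle_signUr ?dj //.
    have [cA|/dQ->] := eqVneq #|A| q; last by rewrite !(mulr0, mul0r).
    have := shuffle_signC (dj _ iA); rewrite cards1 mul1n cA => <-.
    by ring.
Qed.

Lemma contract_rE i p P : mv_degree p P ->
  contract_r i P = (-1) ^+ p.+1 *: contract_l i P.
Proof.
move=> dP; apply/ffunP => S; rewrite !ffunE; case: ifPn => iS; first by rewrite scaler0.
have [cA|/dP->] := eqVneq #|i |: S| p; last by rewrite !mulr0 scaler0.
rewrite -cA cardsU1 iS !exprS mulrA mulrN1 opprK mul1r.
have d : [disjoint [set i] & S] by rewrite disjoints1.
have := shuffle_signC d; rewrite cards1 mul1n => e.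
rewrite -mul_mpolyC rmorphXn rmorphN1 -e -/(sg _ _).
by rewrite !mulrA (mulrAC (sg [set i] S)) shuffle_sign_sqr mul1r.
Qed.

Lemma mv_degree_deriv i p P : mv_degree p P -> mv_degree p (mv_deriv i P).
Proof. by move=> dP S /dP e; rewrite ffunE e mderiv0. Qed.

Lemma mv_degree_contract_l i p P : mv_degree p.+1 P -> mv_degree p (contract_l i P).
Proof.
move=> dP S cS; rewrite ffunE; case: ifPn => // iS.
by rewrite dP ?mulr0 // cardsU1 iS.
Qed.

Lemma mv_degree_contract_r i p P : mv_degree p.+1 P -> mv_degree p (contract_r i P).
Proof.
move=> dP S cS; rewrite ffunE; case: ifPn => // iS.
by rewrite dP ?mulr0 // cardsU1 iS.
Qed.

Lemma contract_l0 i P : mv_degree 0 P -> contract_l i P = 0.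
Proof.
move=> dP; apply/ffunP => S; rewrite !ffunE; case: ifPn => // iS.
by rewrite dP ?mulr0 // cardsU1 iS.
Qed.

Lemma contract_r0 i P : mv_degree 0 P -> contract_r i P = 0.
Proof.
move=> dP; apply/ffunP => S; rewrite !ffunE; case: ifPn => // iS.
by rewrite dP ?mulr0 // cardsU1 iS.
Qed.

(* p.+1 stands for p - 1: it has the same parity, and p = 0 is allowed. *)
Theorem schouten_wedge p q P Q R : mv_degree p P -> mv_degree q Q ->
  schouten P (wedge Q R)
  = wedge (schouten P Q) R + (-1) ^+ (p.+1 * q) *: wedge Q (schouten P R).
Proof.
move=> dP dQ; rewrite /schouten wedge_suml wedge_sumr scaler_sumr -big_split /=.
apply: eq_bigr => i _.
rewrite mv_deriv_wedge (contract_l_wedge _ _ dQ) !(wedgeDl, wedgeDr, wedgeNl, wedgeNr).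
rewrite !wedgeZr !wedgeA scalerBr.
rewrite (wedgeC (mv_degree_deriv i dP) dQ) wedgeZl scalerA -exprD -mulSn.
have -> : wedge (contract_r i P) Q = (-1) ^+ (p.+1 * q) *: wedge Q (contract_r i P).
  case: p dP => [|p] dP; first by rewrite contract_r0 // wedge0l wedge0r scaler0.
  rewrite (wedgeC (mv_degree_contract_r i dP) dQ).
  by rewrite !mulSn addnA addnn sign_double.
rewrite wedgeZl opprD !addrA; congr (_ - _); rewrite -!addrA; congr (_ + _).
by rewrite addrC.
Qed.

Lemma wedge_contract_deriv i p q P Q : mv_degree p P -> mv_degree q Q ->
  wedge (contract_r i P) (mv_deriv i Q)
  = (-1) ^+ (p.+1 * q.+1) *: wedge (mv_deriv i Q) (contract_l i P).
Proof.
move=> dP dQ; case: p dP => [|p] dP.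
  by rewrite contract_r0 // contract_l0 // wedge0l wedge0r scaler0.
rewrite (wedgeC (mv_degree_contract_r i dP) (mv_degree_deriv i dQ)).
rewrite (contract_rE i dP) wedgeZr scalerA -exprD; congr (_ *: _).
have -> : (p.+2 * q.+1 = q.*2 + (p * q + p.+2))%N by rewrite -mul2n; lia.
by rewrite sign_double.
Qed.

Theorem schouten_antisym p q P Q : mv_degree p P -> mv_degree q Q ->
  schouten P Q = - ((-1) ^+ (p.+1 * q.+1) *: schouten Q P).
Proof.
move=> dP dQ; rewrite /schouten scaler_sumr -sumrN; apply: eq_bigr => i _.
rewrite (wedge_contract_deriv i dP dQ) (wedge_contract_deriv i dQ dP).
rewrite scalerBr scalerA mulnC -exprD addnn -[_.*2]addn0 sign_double scale1r.
by rewrite opprB mulnC.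
Qed.

Lemma mv_degree_fun f : mv_degree 0 (mv_fun f).
Proof. by move=> S S0; rewrite ffunE -cards_eq0 (negbTE S0). Qed.

Lemma wedge_funl f P S : wedge (mv_fun f) P S = f * P S.
Proof.
rewrite ffunE (bigD1 set0) ?sub0set //= big1 => [|A /andP[_ /negbTE A0]]; last first.
  by rewrite ffunE A0 mulr0 mul0r.
rewrite addr0 ffunE eqxx setD0 shuffle_signE big1 ?mul1r // => a.
by rewrite inE.
Qed.

Lemma wedge_funr f P S : wedge P (mv_fun f) S = P S * f.
Proof.
rewrite ffunE (bigD1 S) ?subxx //= big1 => [|A /andP[AS A0]]; last first.
  rewrite [mv_fun f _]ffunE setD_eq0 ifN ?mulr0 //.
  by apply: contra A0 => SA; rewrite eqEsubset AS.
rewrite addr0 [mv_fun f _]ffunE setDv eqxx shuffle_signE big1 ?mul1r // => a _.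
by rewrite big1 // => b; rewrite inE.
Qed.

Lemma contract_l_vf i X : mv_degree 1 X -> contract_l i X = mv_fun (X [set i]).
Proof.
move=> dX; apply/ffunP => S; rewrite !ffunE; case: eqVneq => [->|S0].
  rewrite inE setU0 shuffle_signE big1 ?mul1r // => a _.
  by rewrite big1 // => b; rewrite inE.
by case: ifPn => // iS; rewrite dX ?mulr0 // cardsU1 iS add1n eqSS cards_eq0.
Qed.

Lemma contract_r_vf i X : mv_degree 1 X -> contract_r i X = mv_fun (X [set i]).
Proof.
by move=> dX; rewrite (contract_rE i dX) expr2 mulrNN mulr1 scale1r contract_l_vf.
Qed.

Lemma mv_deriv_fun i f : mv_deriv i (mv_fun f) = mv_fun f^`M(i).
Proof. by apply/ffunP => S; rewrite !ffunE; case: eqP => // _; rewrite mderiv0. Qed.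

Theorem schouten_vf_fun X f : mv_degree 1 X ->
  schouten X (mv_fun f) = mv_fun (\sum_(i < n) X [set i] * f^`M(i)).
Proof.
move=> dX; apply/ffunP => S; rewrite /schouten sum_ffunE ffunE.
rewrite (eq_bigr (fun i => if S == set0 then X [set i] * f^`M(i) else 0)).
  by case: eqP => // _; rewrite big1.
move=> i _; rewrite (contract_l0 i (@mv_degree_fun f)) wedge0r subr0.
rewrite contract_r_vf // mv_deriv_fun wedge_funl ffunE.
by case: eqP => // _; rewrite mulr0.
Qed.

Theorem schouten_vf_vf X Y j : mv_degree 1 X -> mv_degree 1 Y ->
  schouten X Y [set j]
  = \sum_(i < n) (X [set i] * (Y [set j])^`M(i) - Y [set i] * (X [set j])^`M(i)).
Proof.
move=> dX dY; rewrite /schouten sum_ffunE; apply: eq_bigr => i _.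
rewrite contract_r_vf // contract_l_vf // ffunE [X in _ + X]ffunE.
rewrite wedge_funl wedge_funr !ffunE.
by rewrite [X in _ - X]mulrC.
Qed.

End SchoutenNormalization.

Section LiePoissonBracket.
Variables (K : fieldType) (L : vectType K) (br : L -> L -> L).
Variables (n : nat) (e : n.-tuple L).
Hypothesis (br_lie : is_lie_bracket br) (e_basis : basis_of fullv e).

Let br_l y : {linear L -> L} := HB.pack (fun x => br x y)
  (GRing.isLinear.Build K L L _ _ (lie_linear_l br_lie y)).
Let br_r x : {linear L -> L} := HB.pack (br x)
  (GRing.isLinear.Build K L L _ _ (lie_linear_r br_lie x)).

Let brDl x x' y : br (x + x') y = br x y + br x' y := linearD (br_l y) x x'.
Let brDr x y y' : br x (y + y') = br x y + br x y' := linearD (br_r x) y y'.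
Let brZl a x y : br (a *: x) y = a *: br x y := linearZ_LR (br_l y) a x.
Let brZr a x y : br x (a *: y) = a *: br x y := linearZ_LR (br_r x) a y.
Let br_suml (F : 'I_n -> L) y : br (\sum_i F i) y = \sum_i br (F i) y :=
  linear_sum (br_l y) _ _ F.
Let br_sumr (F : 'I_n -> L) x : br x (\sum_i F i) = \sum_i br x (F i) :=
  linear_sum (br_r x) _ _ F.

Lemma lie_antisym x y : br x y = - br y x.
Proof.
apply/eqP; rewrite -addr_eq0; have := lie_alternating br_lie (x + y).
by rewrite brDl !brDr !(lie_alternating br_lie) add0r addr0 => /eqP.
Qed.

Let lin_linear : linear (linear_fun e).
Proof.
move=> a x y; rewrite /linear_fun scaler_sumr -big_split; apply: eq_bigr => i _ /=.
by rewrite linearP scalerDl scalerA.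
Qed.
Let lin : {linear L -> {mpoly K[n]}} :=
  HB.pack (linear_fun e) (GRing.isLinear.Build K L _ _ _ lin_linear).

Let linN x : linear_fun e (- x) = - linear_fun e x := linearN lin x.
Let lin0 : linear_fun e 0 = 0 := linear0 lin.
Let linZ a x : linear_fun e (a *: x) = a *: linear_fun e x := linearZ_LR lin a x.
Let lin_sum (F : 'I_n -> L) :
  linear_fun e (\sum_i F i) = \sum_i linear_fun e (F i) := linear_sum lin _ _ F.

Lemma wedge_coord_vf (i j : 'I_n) S : (i < j)%N ->
  wedge (coord_vf K i) (coord_vf K j) S = (S == [set i; j])%:R.
Proof.
move=> ij; rewrite ffunE.
have nji : j \notin [set i] by rewrite inE neq_ltn ij orbT.
have [iS|iS] := boolP (i \in S); last first.
  rewrite big1 => [|A AS]; last first.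
    rewrite ffunE; case: eqP AS => [->|]; rewrite ?mulr0 ?mul0r // sub1set.
    by rewrite (negbTE iS).
  by case: eqP iS => // ->; rewrite !inE eqxx.
rewrite (bigD1 [set i]) ?sub1set //= big1 => [|A /andP[_ /negbTE A0]]; last first.
  by rewrite ffunE A0 mulr0 mul0r.
rewrite !ffunE eqxx mulr1 addr0.
have -> : (S :\: [set i] == [set j]) = (S == [set i; j]).
  apply/eqP/eqP => [<-|->]; first by rewrite setUDK ?sub1set.
  by rewrite setU1K // inE neq_ltn ij.
case: eqP => [->|_]; last by rewrite mulr0.
rewrite mulr1 setU1K ?inE ?neq_ltn ?ij // shuffle_signE.
by rewrite !big_set1 ltnNge ltnW.
Qed.

Lemma lie_poisson_coef (i j : 'I_n) : (i < j)%N ->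
  lie_poisson br e [set i; j] = linear_fun e (br (tnth e i) (tnth e j)).
Proof.
move=> ij; rewrite /lie_poisson sum_ffunE (bigD1 i) //= sum_ffunE (bigD1 j) //=.
rewrite wedge_funl wedge_coord_vf // eqxx mulr1.
have ne (a b : 'I_n) : (a < b)%N -> [set i; j] == [set a; b] -> (a = i) /\ (b = j).
  move=> ab /eqP eq2.
  have : a \in [set i; j] by rewrite eq2 !inE eqxx.
  have : b \in [set i; j] by rewrite eq2 !inE eqxx orbT.
  have : i \in [set a; b] by rewrite -eq2 !inE eqxx.
  have : j \in [set a; b] by rewrite -eq2 !inE eqxx orbT.
  rewrite !inE -!val_eqE /= => h1 h2 h3 h4; split; apply/val_inj => /=; lia.
rewrite big1 => [|b /andP[ib bj]]; last first.
  rewrite wedge_funl wedge_coord_vf //; case: eqP => [/eqP /ne[] // _ eb|_].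
    by rewrite eb eqxx in bj.
  exact: mulr0.
rewrite addr0 big1 ?addr0 // => a ai; rewrite sum_ffunE big1 // => b ab.
rewrite wedge_funl wedge_coord_vf //; case: eqP => [/eqP /ne[] // ea _|_].
  by rewrite ea eqxx in ai.
exact: mulr0.
Qed.

Lemma lie_poisson_degree : mv_degree 2 (lie_poisson br e).
Proof.
move=> S S2; rewrite /lie_poisson sum_ffunE big1 // => i _.
rewrite sum_ffunE big1 // => j ij; rewrite wedge_funl wedge_coord_vf //.
case: (eqVneq S) => [eS|_]; last exact: mulr0.
have nij : i != j by rewrite neq_ltn ij.
by rewrite eS cards2 nij in S2.
Qed.

(* {x, y} = [[pi_1, y], x], since [pi_1, y] contracts dy with the second index. *)
Theorem lie_poisson_bracket x y :
  schouten (hamiltonian (lie_poisson br e) (linear_fun e y)) (mv_fun (linear_fun e x))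
  = mv_fun (linear_fun e (br x y)).
Proof.
set P := lie_poisson br e.
have hamE f S : hamiltonian P f S = \sum_(k < n) contract_r k P S * f^`M(k).
  rewrite /hamiltonian /schouten sum_ffunE; apply: eq_bigr => k _.
  by rewrite (contract_l0 k (@mv_degree_fun _ _ f)) wedge0r subr0 mv_deriv_fun wedge_funr.
have ham1 f : mv_degree 1 (hamiltonian P f).
  move=> S S1; rewrite hamE big1 // => k _.
  by rewrite (mv_degree_contract_r k lie_poisson_degree S1) mul0r.
have dlin z k : (linear_fun e z)^`M(k) = (coord e k z)%:MP.
  rewrite /linear_fun raddf_sum (bigD1 k) //= mderivZ mderivX.
  rewrite big1 => [|i ik]; last first.
    by rewrite mderivZ mderivX mnmE (negbTE ik) scale0r scaler0.
  rewrite mnmE eqxx addr0 scale1r.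
  have -> : (U_(k) - U_(k) = 0 :> 'X_{1..n})%MM by apply/mnmP=> l; rewrite !mnmE subnn.
  by rewrite mpolyX0 -mul_mpolyC mulr1.
have cP i k : contract_r k P [set i] = linear_fun e (br (tnth e i) (tnth e k)).
  rewrite ffunE inE; case: eqP => [->|/eqP ki].
    by rewrite (lie_alternating br_lie) lin0.
  rewrite shuffle_signE !big_set1.
  move: ki; rewrite neq_ltn => /orP[ki|ik].
    by rewrite ki lie_poisson_coef // expr1 mulN1r lie_antisym linN opprK.
  by rewrite ltnNge ltnW //= mul1r setUC lie_poisson_coef.
rewrite schouten_vf_fun //; congr mv_fun.
rewrite [in RHS](coord_basis e_basis (memvf x)) [in RHS](coord_basis e_basis (memvf y)).
rewrite br_suml lin_sum; apply: eq_bigr => i _.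
rewrite brZl br_sumr linZ lin_sum dlin mulrC mul_mpolyC hamE; congr (_ *: _).
apply: eq_bigr => k _.
rewrite cP dlin mulrC mul_mpolyC brZr linZ.
by rewrite -!tnth_nth.
Qed.

End LiePoissonBracket.

(* Main.v *)
From HB Require Import structures.
Require Import Defs.
From mathcomp Require Import all_boot all_order all_algebra.
From mathcomp Require Import reals complex mpoly fraction.
From mathcomp Require Import ring zify.
From mathcomp Require boolp.

(** Write [pi1] for the Lie-Poisson bivector, [Y = pi1(q)] and [W = [pi, Y]].

    The graded Jacobi identity gives [[pi, [pi, pi]] = 0] for every bivector, so
    the hypothesis yields [[pi, Y /\ pi1] = 0].  By the Leibniz rule this is
    [W /\ pi1 - Y /\ [pi, pi1] = 0].  Now [[pi1, pi1] = 0], by the Jacobi identity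
    of the Lie algebra, so the bracket with [pi1] squares to zero; it kills
    [pi = - [pi1, X]], and what remains is [W /\ pi1 = 0].

    At a point where [pi1] has rank at least 6, the product with [pi1] is
    injective on bivectors, just as the product with the symplectic form is
    injective on 2-forms of a symplectic space of dimension at least 6.  Such
    points are generic and the coefficients of [W] are polynomials, so [W = 0].

    The graded Jacobi identity enters through [schouten_sqr], the vanishing of
    [[pi1, pi1]] is [schouten_lie_poisson], and the injectivity is
    [skew_wedge_inj], a statement on skew matrices over a field.  It is applied
    over the fraction field of the polynomial ring ([wedge_bivector_inj]), which
    takes care of generic points all at once. *)

Set Implicit Arguments.
Unset Strict Implicit.
Unset Printing Implicit Defensive.

Import GRing.Theory.
Local Open Scope ring_scope.

(** * Torsion, and sums with symmetries *)

Lemma lmod_mulrn_inj (K : fieldType) (V : lmodType K) m (x : V) :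
  [pchar K] =i pred0 -> x *+ m.+1 = 0 -> x = 0.
Proof.
by move=> /(pcharf0P K).1 char0 /eqP; rewrite -scaler_nat scaler_eq0 char0 => /eqP.
Qed.

Lemma sum_antisym n (V : zmodType) (a : 'I_n -> 'I_n -> V) :
  (forall i j, a j i = - a i j) -> (\sum_i \sum_j a i j) *+ 2 = 0.
Proof.
move=> aC; rewrite mulr2n {2}exchange_big -big_split big1 //= => i _.
by rewrite -big_split big1 //= => j _; rewrite (aC i j) subrr.
Qed.

Lemma sum_cyclic (V : zmodType) n (t : 'I_n -> 'I_n -> 'I_n -> V) :
  (forall i j k, t i j k + t j k i + t k i j = 0) ->
  (\sum_i \sum_j \sum_k t i j k) *+ 3 = 0.
Proof.
move=> t0; have rot (u : 'I_n -> 'I_n -> 'I_n -> V) :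
    \sum_i \sum_j \sum_k u j k i = \sum_i \sum_j \sum_k u i j k.
  by rewrite exchange_big; apply: eq_bigr => j _; rewrite exchange_big.
transitivity (\sum_i \sum_j \sum_k (t i j k + t j k i + t k i j)); last first.
  by rewrite big1 // => i _; rewrite big1 // => j _; rewrite big1.
under [RHS]eq_bigr do (under eq_bigr do rewrite !big_split /=; rewrite !big_split /=).
by rewrite !big_split /= (rot t) -(rot (fun i j k => t k i j)) mulrS mulr2n addrA.
Qed.

(** * Contractions, derivatives and degrees of multivector fields *)

Section Exterior.
Variables (K : fieldType) (n : nat).
Implicit Types (P Q R W : multivector K n) (i j k l : 'I_n) (S : {set 'I_n}).

Fact contract_l_is_zmod_morphism i : zmod_morphism (@contract_l K n i).
Proof.
move=> P Q; apply/ffunP => S; rewrite !ffunE.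
by case: ifP => _; rewrite ?subr0 // mulrBr.
Qed.
HB.instance Definition _ i := GRing.isZmodMorphism.Build
  (multivector K n) (multivector K n) (@contract_l K n i)
  (contract_l_is_zmod_morphism i).

Fact mv_deriv_is_zmod_morphism i : zmod_morphism (@mv_deriv K n i).
Proof. by move=> P Q; apply/ffunP => S; rewrite !ffunE mderivB. Qed.
HB.instance Definition _ i := GRing.isZmodMorphism.Build
  (multivector K n) (multivector K n) (@mv_deriv K n i)
  (mv_deriv_is_zmod_morphism i).

Fact schouten_is_zmod_morphism P : zmod_morphism (schouten P).
Proof.
move=> Q R; rewrite /schouten -sumrB; apply: eq_bigr => i _.
by rewrite !raddfB /= !(wedgeDr, wedgeNr) !opprD !opprK addrACA.
Qed.
HB.instance Definition _ P := GRing.isZmodMorphism.Build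
  (multivector K n) (multivector K n) (schouten P)
  (schouten_is_zmod_morphism P).

Lemma contract_l_anticomm i j P :
  contract_l j (contract_l i P) = - contract_l i (contract_l j P).
Proof.
apply/ffunP => S; rewrite !ffunE !inE.
have [jS|jS] := boolP (j \in S).
  by rewrite orbT; case: ifP; rewrite ?mulr0 oppr0.
have [iS|iS] := boolP (i \in S); first by rewrite orbT mulr0 oppr0.
rewrite !orbF [j == i]eq_sym; case: eqP => [|/eqP ij]; first by rewrite !mulr0 oppr0.
have dij : [disjoint [set i] & [set j]] by rewrite disjoints1 inE.
rewrite !shuffle_signUr ?disjoints1 // setUCA.
have := shuffle_signC K dij; rewrite !cards1 expr1 => sg2.
have := shuffle_sign_sqr K [set i] [set j].
move: (P _) (shuffle_sign K [set i] [set j]) (shuffle_sign K [set j] [set i]) sg2.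
move=> x a b ab aa; have -> : b = - a by rewrite -[b]mul1r -aa -mulrA ab mulrN1.
by ring.
Qed.

Lemma mv_deriv_contract_l i j P :
  mv_deriv i (contract_l j P) = contract_l j (mv_deriv i P).
Proof.
apply/ffunP => S; rewrite !ffunE; case: ifP => _; first exact: mderiv0.
rewrite /shuffle_sign -(rmorphN1 (@mpolyC n K)) -rmorphXn.
by rewrite !mul_mpolyC mderivZ.
Qed.

Lemma mv_derivC i j P : mv_deriv i (mv_deriv j P) = mv_deriv j (mv_deriv i P).
Proof. by apply/ffunP => S; rewrite !ffunE mderiv_comm. Qed.

Lemma mv_degree_wedge p q P Q :
  mv_degree p P -> mv_degree q Q -> mv_degree (p + q) (wedge P Q).
Proof.
move=> dP dQ S cS; rewrite ffunE big1 // => A AS.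
have [cA|/dP ->] := eqVneq #|A| p; last by rewrite mulr0 mul0r.
rewrite dQ ?mulr0 //; apply: contraNneq cS => cB.
by rewrite -(cardsID A S) (setIidPr AS) cA cB.
Qed.

Lemma mv_degreeB p P Q : mv_degree p P -> mv_degree p Q -> mv_degree p (P - Q).
Proof. by move=> dP dQ S cS; rewrite !ffunE dP // dQ // subr0. Qed.

Lemma mv_degree_sum p (F : 'I_n -> multivector K n) :
  (forall i, mv_degree p (F i)) -> mv_degree p (\sum_i F i).
Proof. by move=> dF S cS; rewrite sum_ffunE big1 // => i _; apply: dF. Qed.

Lemma mv_degree_schouten p q P Q :
  mv_degree p.+1 P -> mv_degree q Q -> mv_degree (p + q) (schouten P Q).
Proof.
move=> dP dQ; apply: mv_degree_sum => i; apply: mv_degreeB.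
  by apply: mv_degree_wedge; [exact: mv_degree_contract_r | exact: mv_degree_deriv].
case: q dQ => [|q] dQ; first by rewrite contract_l0 // wedge0r => S; rewrite ffunE.
rewrite addnS -addSn.
by apply: mv_degree_wedge; [exact: mv_degree_deriv | exact: mv_degree_contract_l].
Qed.

Lemma wedge_bivectorC p P Q : mv_degree p P -> mv_degree 2 Q ->
  wedge P Q = wedge Q P.
Proof. by move=> dP dQ; rewrite (wedgeC dP dQ) -signr_odd oddM andbF scale1r. Qed.

(** The interior products are the derivatives with respect to the odd
    generators, so this is Euler's identity for homogeneous polynomials. *)
Lemma euler_exterior p P : mv_degree p P ->
  \sum_i wedge (coord_vf K i) (contract_l i P) = P *+ p.
Proof.
move=> dP; apply/ffunP => S; rewrite sum_ffunE.
have coefE i : wedge (coord_vf K i) (contract_l i P) S = P S *+ (i \in S).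
  rewrite ffunE; have [iS|iS] := boolP (i \in S); last first.
    rewrite big1 // => A AS; rewrite ffunE.
    case: eqP AS => [->|]; last by rewrite mulr0 mul0r.
    by rewrite sub1set (negbTE iS).
  rewrite (bigD1 [set i]) ?sub1set //= big1 => [|A /andP[_ /negbTE A0]]; last first.
    by rewrite ffunE A0 mulr0 mul0r.
  rewrite !ffunE eqxx mulr1 addr0 !inE eqxx setD1K //.
  by rewrite mulrA shuffle_sign_sqr mul1r.
under eq_bigr do rewrite coefE.
rewrite sumrMnr.
have -> : (\sum_(i < n) (i \in S))%N = #|S|.
  by rewrite -sum1_card [RHS]big_mkcond; apply: eq_bigr => i _; case: ifP.
rewrite ffunMnE.
by have [->|/dP ->] := eqVneq #|S| p; rewrite ?mul0rn.
Qed.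

End Exterior.

(** * The Schouten bracket with a bivector *)

Section SchoutenBivector.
Variables (K : fieldType) (n : nat).
Implicit Types (P Q : multivector K n) (i j : 'I_n) (S : {set 'I_n}).

Lemma schouten_bivector P Q : mv_degree 2 P ->
  schouten P Q = - \sum_i (wedge (contract_l i P) (mv_deriv i Q)
                           + wedge (mv_deriv i P) (contract_l i Q)).
Proof.
move=> dP; rewrite -sumrN; apply: eq_bigr => i _.
by rewrite (contract_rE i dP) -signr_odd scaleN1r wedgeNl opprD.
Qed.

Lemma schouten_trivector P Q : mv_degree 3 P ->
  schouten P Q = \sum_i (wedge (contract_l i P) (mv_deriv i Q)
                         - wedge (mv_deriv i P) (contract_l i Q)).
Proof.
move=> dP; apply: eq_bigr => i _.
by rewrite (contract_rE i dP) -signr_odd scale1r.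
Qed.

(** By the formula for the bracket with a bivector, a contraction of [[P, P]] is
    a sum of products that are equal in pairs: factors of even degree commute
    with everything, vector fields anticommute, and so do contractions.  This
    and [mv_deriv_schouten_self] give the coefficients of the bracket with the
    trivector [[P, P]]. *)
Lemma contract_l_schouten_self j P : mv_degree 2 P ->
  contract_l j (schouten P P) = - schouten P (contract_l j P) *+ 2.
Proof.
move=> dP; rewrite !schouten_bivector // raddfN raddf_sum opprK -sumrN -sumrMnl.
apply: eq_bigr => i _; have dcP := mv_degree_contract_l _ dP.
have ddP := mv_degree_deriv _ dP.
rewrite raddfD /= (contract_l_wedge _ _ (dcP i)) (contract_l_wedge _ _ (ddP i)).
rewrite -signr_odd scaleN1r -[_ ^+ 2]signr_odd scale1r -mv_deriv_contract_l.
rewrite (wedge_bivectorC (mv_degree_contract_l j (dcP i)) (ddP i)).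
rewrite (wedgeC (mv_degree_deriv i (dcP j)) (dcP i)) scaleN1r.
rewrite (contract_l_anticomm i j) wedgeNr.
move: (wedge (mv_deriv i P) _) (wedge (contract_l i P) _) => a b.
by apply/ffunP => S; rewrite !(mulr2n, ffunE); ring.
Qed.

Lemma mv_deriv_schouten_self j P : mv_degree 2 P ->
  mv_deriv j (schouten P P) = schouten P (mv_deriv j P) *+ 2.
Proof.
move=> dP; rewrite !schouten_bivector // raddfN raddf_sum mulNrn -sumrMnl.
congr (- _); apply: eq_bigr => i _; have dcP := mv_degree_contract_l _ dP.
have ddP := mv_degree_deriv _ dP.
rewrite raddfD /= !mv_deriv_wedge -mv_deriv_contract_l (mv_derivC i j).
rewrite (wedge_bivectorC (mv_degree_deriv j (dcP i)) (ddP i)).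
rewrite -(wedge_bivectorC (dcP i) (mv_degree_deriv j (ddP i))).
move: (wedge (mv_deriv i P) _) (wedge (contract_l i P) _) => a b.
by apply/ffunP => S; rewrite !(mulr2n, ffunE); ring.
Qed.

(** The bracket with a bivector [P] is an odd derivation [D], so its square is
    half of an inner derivation; this is the graded Jacobi identity for
    [P, P, Q].  Apply [D] again to the formula of [schouten_bivector] for
    [D Q].  The terms in which the second [D] meets [P] form [[P, P], Q], by the
    two preceding lemmas.  In the terms in which it meets [Q], two derivatives
    of [P] multiply a second derivative of [Q], antisymmetrically under the
    exchange of the two summation indices. *)
Lemma schouten_sqr P Q : mv_degree 2 P ->
  schouten P (schouten P Q) *+ 2 = schouten (schouten P P) Q.
Proof.
move=> dP; have dcP := mv_degree_contract_l _ dP.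
have ddP := mv_degree_deriv _ dP.
rewrite (schouten_trivector _ (mv_degree_schouten dP dP)).
have cdT i : wedge (contract_l i (schouten P P)) (mv_deriv i Q)
      - wedge (mv_deriv i (schouten P P)) (contract_l i Q)
    = (- wedge (schouten P (contract_l i P)) (mv_deriv i Q)
       - wedge (schouten P (mv_deriv i P)) (contract_l i Q)) *+ 2.
  rewrite contract_l_schouten_self // mv_deriv_schouten_self //.
  by rewrite !(mulr2n, wedgeDl, wedgeNl) opprD addrACA.
rewrite (eq_bigr _ (fun i _ => cdT i)).
rewrite [in schouten P (schouten P Q)](schouten_bivector Q dP).
rewrite raddfN (raddf_sum (schouten P)) /=.
under eq_bigr do
  rewrite raddfD /= (schouten_wedge _ dP (dcP _)) (schouten_wedge _ dP (ddP _)).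
apply/eqP; rewrite -subr_eq0; apply/eqP.
(* a i j collects the terms with a second derivative of Q. *)
pose a i j := wedge (contract_l i P) (wedge (contract_l j P) (mv_deriv j (mv_deriv i Q)))
  + wedge (contract_l i P) (wedge (mv_deriv j P) (contract_l j (mv_deriv i Q)))
  - wedge (mv_deriv i P) (wedge (contract_l j P) (mv_deriv j (contract_l i Q)))
  - wedge (mv_deriv i P) (wedge (mv_deriv j P) (contract_l j (contract_l i Q))).
have aC i j : a j i = - a i j.
  rewrite /a !wedgeA (mv_derivC i j) (contract_l_anticomm i j) wedgeNr.
  rewrite !mv_deriv_contract_l.
  rewrite (wedgeC (dcP j) (dcP i)) scaleN1r wedgeNl (wedge_bivectorC (dcP j) (ddP i)).
  rewrite -(wedge_bivectorC (dcP i) (ddP j)) (wedge_bivectorC (ddP j) (ddP i)).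
  move: (wedge _ _) (wedge _ _) (wedge _ _) (wedge _ _) => x y z t.
  by apply/ffunP => S; rewrite !ffunE; ring.
rewrite -sumrN -sumrMnl -sumrB.
transitivity (- ((\sum_i \sum_j a i j) *+ 2)); last by rewrite sum_antisym ?oppr0.
rewrite -mulNrn -sumrN -sumrMnl.
apply: eq_bigr => i _.
have -> : \sum_j a i j = - wedge (contract_l i P) (schouten P (mv_deriv i Q))
   + wedge (mv_deriv i P) (schouten P (contract_l i Q)).
  rewrite !schouten_bivector // !wedgeNr opprK !wedge_sumr -sumrB; apply: eq_bigr => j _.
  by rewrite !wedgeDr /a opprD addrA.
rewrite -signr_odd /= scaleN1r -[_ ^+ (3 * 2)]signr_odd scale1r.
move: (wedge _ _) (wedge _ _) (wedge _ _) (wedge _ _) => x y z t.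
by apply/ffunP => S; rewrite !(mulr2n, ffunE); ring.
Qed.

Lemma schouten0l Q : schouten 0 Q = 0.
Proof.
rewrite /schouten big1 // => i _; have -> : contract_r i (0 : multivector K n) = 0.
  by apply/ffunP => S; rewrite !ffunE mulr0 if_same.
by rewrite raddf0 !wedge0l subr0.
Qed.

Lemma schouten_bivector_self_self P : [pchar K] =i pred0 -> mv_degree 2 P ->
  schouten P (schouten P P) = 0.
Proof.
move=> char0 dP; have := schouten_sqr P dP.
rewrite (schouten_antisym (mv_degree_schouten dP dP) dP) -signr_odd scale1r => /eqP.
by rewrite -addr_eq0 -mulrSr => /eqP; apply: lmod_mulrn_inj.
Qed.

Lemma schouten_poisson_sqr P Q : [pchar K] =i pred0 -> mv_degree 2 P ->
  schouten P P = 0 -> schouten P (schouten P Q) = 0.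
Proof.
move=> char0 dP PP0; apply: (lmod_mulrn_inj char0 (m := 1)).
by rewrite schouten_sqr // PP0 schouten0l.
Qed.

End SchoutenBivector.

(** * The Lie-Poisson bivector is a Poisson structure *)

Section LiePoissonJacobi.
Variables (K : fieldType) (L : vectType K) (br : L -> L -> L).
Variables (n : nat) (e : n.-tuple L).
Hypotheses (char0 : [pchar K] =i pred0).
Hypotheses (br_lie : is_lie_bracket br) (e_basis : basis_of fullv e).
Implicit Types (P Q R W : multivector K n) (i j k l : 'I_n) (S : {set 'I_n}).

Fact linear_fun_is_linear : linear (linear_fun e).
Proof.
move=> a x y; rewrite /linear_fun scaler_sumr -big_split; apply: eq_bigr => i _ /=.
by rewrite linearP scalerDl scalerA.
Qed.
HB.instance Definition _ := GRing.isLinear.Build K L {mpoly K[n]} _ (linear_fun e)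
  linear_fun_is_linear.
Let br_l y : {linear L -> L} := HB.pack (fun x => br x y)
  (GRing.isLinear.Build K L L _ _ (lie_linear_l br_lie y)).

Lemma linear_fun_br x y :
  linear_fun e (br x y) = \sum_i coord e i x *: linear_fun e (br (tnth e i) y).
Proof.
rewrite {1}(coord_basis e_basis (memvf x)).
have -> : br (\sum_i coord e i x *: e`_i) y = \sum_i coord e i x *: br e`_i y.
  have := linear_sum (br_l y); rewrite /= => ->; apply: eq_bigr => i _.
  exact: (linearZ_LR (br_l y)).
by rewrite linear_sum; apply: eq_bigr => i _; rewrite linearZ_LR -tnth_nth.
Qed.

Lemma mderiv_linear_fun x i : (linear_fun e x)^`M(i) = (coord e i x)%:MP.
Proof.
rewrite /linear_fun raddf_sum (bigD1 i) //= mderivZ mderivX big1 => [|j ji]; last first.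
  by rewrite mderivZ mderivX mnmE (negbTE ji) scale0r scaler0.
rewrite mnmE eqxx addr0 scale1r -{1}[U_(i)%MM]add0m addmK.
by rewrite mpolyX0 -mul_mpolyC mulr1.
Qed.

Lemma linear_fun_jacobi x y z : linear_fun e (br (br x y) z)
  + linear_fun e (br (br y z) x) + linear_fun e (br (br z x) y) = 0.
Proof.
rewrite -!raddfD /= !(lie_antisym br_lie (br _ _)) -!opprD.
by rewrite -addrA addrC (lie_jacobi br_lie) oppr0 raddf0.
Qed.

Lemma mv_degree_coord_vf i : mv_degree 1 (coord_vf K i).
Proof. by move=> S; rewrite ffunE; case: (eqVneq S) => [->|//]; rewrite cards1. Qed.

(** The Hamiltonian vector field of the coordinate [e_i], up to sign. *)
Lemma contract_lie_poisson i : contract_l i (lie_poisson br e)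
  = \sum_j wedge (mv_fun (linear_fun e (br (tnth e i) (tnth e j)))) (coord_vf K j).
Proof.
apply/ffunP => S; rewrite sum_ffunE.
under eq_bigr do rewrite wedge_funl ffunE.
have [/cards1P[j ->]|S1] := boolP (#|S| == 1%N); last first.
  rewrite (mv_degree_contract_l i (lie_poisson_degree br e)) // big1 // => j _.
  by case: (eqVneq S) S1 => [->|]; rewrite ?cards1 // mulr0.
rewrite (bigD1 j) //= eqxx mulr1 big1 => [|b bj]; last first.
  by rewrite (inj_eq set1_inj) eq_sym (negbTE bj) mulr0.
rewrite addr0 ffunE inE; case: eqP => [->|/eqP ij].
  by rewrite (lie_alternating br_lie) raddf0.
rewrite shuffle_signE !big_set1; move: ij; rewrite neq_ltn => /orP[ij|ji].
  by rewrite ltnNge ltnW //= mul1r lie_poisson_coef.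
by rewrite ji setUC lie_poisson_coef // mulN1r (lie_antisym br_lie) raddfN opprK.
Qed.

Lemma mv_deriv_coord_vf i j : mv_deriv i (coord_vf K j) = 0.
Proof. by apply/ffunP => S; rewrite !ffunE -mpolyC_nat mderivC. Qed.

Lemma mv_deriv_contract_lie_poisson i j :
  mv_deriv j (contract_l i (lie_poisson br e))
  = \sum_k coord e j (br (tnth e i) (tnth e k)) *: coord_vf K k.
Proof.
rewrite contract_lie_poisson raddf_sum; apply: eq_bigr => k _.
rewrite /= mv_deriv_wedge mv_deriv_fun mderiv_linear_fun.
rewrite mv_deriv_coord_vf wedge0r addr0; apply/ffunP => S.
by rewrite wedge_funl !ffunE mul_mpolyC.
Qed.

(** Up to a factor, the bracket is the sum over [i] of the contraction of [pi1]
    with [dx_i], of coefficients [[e_i, e_j]], times the derivative of [pi1] along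
    [x_i], of coefficients the [e_i]-coordinates of [[e_a, e_b]].  Summing over [i]
    composes the two Lie brackets, and leaves the sum over [j, a, b] of the linear
    function [[[e_a, e_b], e_j]] times [d_j /\ d_a /\ d_b].  That product of three
    vector fields is invariant under cyclic permutations, so only the cyclic
    sums of the coefficients matter, and these vanish by the Jacobi identity. *)
Lemma schouten_lie_poisson : schouten (lie_poisson br e) (lie_poisson br e) = 0.
Proof.
set P := lie_poisson br e; have dP : mv_degree 2 P := lie_poisson_degree br e.
pose t j a b := wedge (mv_fun (linear_fun e (br (br (tnth e a) (tnth e b)) (tnth e j))))
  (wedge (coord_vf K j) (wedge (coord_vf K a) (coord_vf K b))).
have dx := mv_degree_coord_vf.
have cyc a b j : wedge (coord_vf K a) (wedge (coord_vf K b) (coord_vf K j))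
    = wedge (coord_vf K j) (wedge (coord_vf K a) (coord_vf K b)).
  by rewrite wedgeA (wedge_bivectorC (dx j) (mv_degree_wedge (dx a) (dx b))).
have t_cycle j a b : t j a b + t a b j + t b j a = 0.
  rewrite /t (cyc b j a) (cyc a b j) -!wedgeDl; apply/ffunP => S.
  have -> : wedge (mv_fun (linear_fun e (br (br (tnth e a) (tnth e b)) (tnth e j))) +
      mv_fun (linear_fun e (br (br (tnth e b) (tnth e j)) (tnth e a))) +
      mv_fun (linear_fun e (br (br (tnth e j) (tnth e a)) (tnth e b))))
      (wedge (coord_vf K j) (wedge (coord_vf K a) (coord_vf K b))) = wedge (mv_fun 0)
      (wedge (coord_vf K j) (wedge (coord_vf K a) (coord_vf K b))).
    congr wedge; apply/ffunP => U; rewrite !ffunE.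
    case: ifP => _; last by rewrite !addr0.
    exact: linear_fun_jacobi.
  by rewrite wedge_funl mul0r ffunE.
have sum_t0 : \sum_j \sum_a \sum_b t j a b = 0.
  by apply: (lmod_mulrn_inj char0 (m := 2)); apply: sum_cyclic.
have doubled : (\sum_i wedge (contract_l i P) (mv_deriv i P)) *+ 2
    = \sum_j \sum_a \sum_b t j a b.
  have derivE i : mv_deriv i P *+ 2 = \sum_a wedge (coord_vf K a)
      (\sum_b coord e i (br (tnth e a) (tnth e b)) *: coord_vf K b).
    rewrite -raddfMn -(euler_exterior dP) raddf_sum; apply: eq_bigr => a _.
    rewrite /= mv_deriv_wedge -mv_deriv_contract_lie_poisson.
    by rewrite mv_deriv_coord_vf wedge0l add0r.
  rewrite -sumrMnl.
  transitivity (\sum_i \sum_j \sum_a \sum_b coord e i (br (tnth e a) (tnth e b)) *: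
    wedge (mv_fun (linear_fun e (br (tnth e i) (tnth e j))))
      (wedge (coord_vf K j) (wedge (coord_vf K a) (coord_vf K b)))).
    apply: eq_bigr => i _; rewrite mulr2n -wedgeDr -mulr2n derivE contract_lie_poisson.
    rewrite wedge_suml; apply: eq_bigr => j _; rewrite wedge_sumr; apply: eq_bigr => a _.
    rewrite !wedge_sumr; apply: eq_bigr => b _.
    by rewrite !wedgeZr !wedgeA.
  rewrite exchange_big; apply: eq_bigr => j _ /=.
  rewrite exchange_big; apply: eq_bigr => a _ /=.
  rewrite exchange_big; apply: eq_bigr => b _ /=; apply/ffunP => S.
  rewrite /t wedge_funl linear_fun_br mulr_suml sum_ffunE; apply: eq_bigr => i _.
  by rewrite ffunE wedge_funl scalerAl.
rewrite schouten_bivector //; apply/eqP; rewrite oppr_eq0; apply/eqP.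
apply: etrans sum_t0; rewrite -doubled -sumrMnl; apply: eq_bigr => i _.
by rewrite (wedge_bivectorC (mv_degree_contract_l i dP) (mv_degree_deriv i dP)).
Qed.

End LiePoissonJacobi.

(** * Skew matrices and generic rank *)

Section LinearAlgebra.
Variable F : fieldType.

(** In a rank factorization [A = c d] of an idempotent, [d c] is the identity
    of size the rank, and it has the same trace as [A]. *)
Lemma mxtrace_idem n (A : 'M[F]_n) : A *m A = A -> \tr A = (\rank A)%:R.
Proof.
move=> idA; rewrite -{1}(mulmx_base A) mxtrace_mulC.
suff -> : row_base A *m col_base A = 1%:M by rewrite mxtrace1.
have [B BC] := row_fullP (col_base_full A); have [C RC] := row_freeP (row_base_free A).
have := idA; rewrite -{1 2 3}(mulmx_base A).
move: (col_base A) (row_base A) BC RC => c d Bc dC /(congr1 (fun M => B *m M *m C)).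
by rewrite !mulmxA Bc mul1mx -!mulmxA dC !mulmx1.
Qed.

(** For any [g] with [p g p = p], the transpose [- g^T] satisfies the same
    equation, so [- g p g^T] is a reflexive generalized inverse; it is skew. *)
Lemma skew_ginv n (p : 'M[F]_n) : p^T = - p ->
  exists q : 'M[F]_n, [/\ q^T = - q, p *m q *m p = p & q *m p *m q = q].
Proof.
move=> pT; have [g pgp] : exists g, p *m g *m p = p.
  by exists (pinvmx p); apply: mulmxKpV.
have pgTp : p *m g^T *m p = - p.
  by have := congr1 trmx pgp; rewrite !trmx_mul pT !(mulNmx, mulmxN) opprK mulmxA.
exists (- (g *m p *m g^T)); split.
- by rewrite linearN /= !trmx_mul trmxK pT !(mulNmx, mulmxN) mulmxA.
- by rewrite mulmxN mulNmx !mulmxA pgp pgTp opprK.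
- rewrite mulmxN !mulNmx opprK.
  have -> : g *m p *m g^T *m p *m (g *m p *m g^T)
      = g *m (p *m g^T *m p) *m g *m p *m g^T by rewrite !mulmxA.
  rewrite pgTp mulmxN !mulNmx.
  have -> : g *m p *m g *m p = g *m (p *m g *m p) by rewrite !mulmxA.
  by rewrite pgp.
Qed.

Lemma skew_mx_entry n (a : 'M[F]_n) : a^T = - a -> forall i j, a i j = - a j i.
Proof. by move=> aT i j; have /matrixP/(_ j i) := aT; rewrite !mxE. Qed.

(** The linear fact behind the rank hypothesis: on an [r]-dimensional symplectic
    space with [r > 4], the product with the symplectic form is injective on
    2-forms; here [p] may be degenerate.  The hypothesis on the entries is
    [w /\ p = 0].

    Contract it with a skew generalized inverse [q] of [p].  With
    [c = - tr (w q)] this gives [r w = 2 (w q p + p q w) + c p].  The products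
    [p q] and [q p] are projections of rank [r], so they split [w] into blocks,
    on which the equation becomes [(r - 4) w = c p], [(r - 2) w = 0] and
    [r w = 0].  Taking the trace of the first against [q] gives
    [2 (r - 2) c = 0].  None of [2], [r], [r - 2], [r - 4] vanishes, so
    [w = 0]. *)
Lemma skew_wedge_inj n (w p : 'M[F]_n) :
  w^T = - w -> p^T = - p ->
  (forall m, (0 < m <= \rank p)%N -> m%:R != 0 :> F) -> (4 < \rank p)%N ->
  (forall i j k l, w i j * p k l - w i k * p j l + w i l * p j k
     + w j k * p i l - w j l * p i k + w k l * p i j = 0) ->
  w = 0.
Proof.
move=> wT pT char_r r4 wp0; set r := \rank p in char_r r4.
have [q [qT pqp qpq]] := skew_ginv pT.
have pqpr (a : 'M[F]_n) : a *m p *m q *m p = a *m p.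
  by rewrite -!mulmxA (mulmxA p) pqp.
have qpqr (a : 'M[F]_n) : a *m q *m p *m q = a *m q.
  by rewrite -!mulmxA (mulmxA q) qpq.
have wS := skew_mx_entry wT.
have pS := skew_mx_entry pT.
have qS := skew_mx_entry qT.
have rkpq : \rank (p *m q) = r.
  apply/eqP; rewrite eqn_leq mxrankM_maxl /= /r -{1}pqp.
  exact: mxrankM_maxl.
have trpq : \tr (p *m q) = r%:R by rewrite mxtrace_idem ?rkpq // mulmxA pqp.
pose c := - \tr (w *m q).
have trE (a : 'M[F]_n) : \sum_k \sum_l q k l * a k l = - \tr (a *m q).
  rewrite -sumrN; apply: eq_bigr => k _; rewrite mxE -sumrN.
  by apply: eq_bigr => l _; rewrite (qS k l) mulNr mulrC.
(* The sum over k and l of q k l times the six-term relation. *)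
have contracted : r%:R *: w = 2%:R *: (w *m q *m p + p *m q *m w) + c *: p.
  apply/matrixP => i j.
  have : \sum_k \sum_l q k l * (w i j * p k l - w i k * p j l + w i l * p j k
     + w j k * p i l - w j l * p i k + w k l * p i j) = 0.
    by rewrite big1 // => k _; rewrite big1 // => l _; rewrite wp0 mulr0.
  have -> : \sum_k \sum_l q k l * (w i j * p k l - w i k * p j l + w i l * p j k
     + w j k * p i l - w j l * p i k + w k l * p i j)
   = w i j * (\sum_k \sum_l q k l * p k l) + \sum_k \sum_l w i k * q k l * p l j
     + \sum_k \sum_l w i l * q l k * p k j + \sum_k \sum_l p i l * q l k * w k j
     + \sum_k \sum_l p i k * q k l * w l j + p i j * (\sum_k \sum_l q k l * w k l).
    rewrite !mulr_sumr -!big_split; apply: eq_bigr => k _.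
    rewrite /= !mulr_sumr -!big_split; apply: eq_bigr => l _ /=.
    by rewrite (pS l j) (pS k j) (qS l k) (wS k j) (wS l j); ring.
  rewrite !trE trpq -/c [X in _ + X + _ + _]exchange_big.
  rewrite [X in _ + X + _ + _ + _]exchange_big /=.
  have mul3 (x y z : 'M[F]_n) : \sum_k \sum_l x i k * y k l * z l j = (x *m y *m z) i j.
    rewrite exchange_big mxE; apply: eq_bigr => l _ /=.
    by rewrite mxE mulr_suml.
  rewrite !mul3 !mxE => e; apply/eqP; rewrite -subr_eq0 -oppr_eq0.
  by apply/eqP; rewrite -[RHS]e; ring.
(* The block of w on the image of p, to which c p belongs. *)
pose A := p *m q *m w *m q *m p.
have eA : (r%:R - 4) *: A = c *: p.
  have := congr1 (fun M => p *m q *m M *m q *m p) contracted.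
  rewrite /= !(mulmxDr, mulmxDl) -!(scalemxAr, scalemxAl) !(mulmxDr, mulmxDl) !mulmxA.
  rewrite !(pqpr, pqp) -/A => e.
  by apply/matrixP => i j; have /matrixP/(_ i j) := e; rewrite !mxE mulrBl => ->; ring.
have trA : \tr (A *m q) = - c.
  by rewrite /A qpqr mxtrace_mulC !mulmxA qpq mxtrace_mulC opprK.
have nz m : (0 < m <= r)%N -> m%:R != 0 :> F := @char_r m.
have subN m : (m <= r)%N -> r%:R - m%:R = (r - m)%:R :> F by move/natrB.
have c0 : c = 0.
  have := congr1 (fun M => \tr (M *m q)) eA.
  rewrite /= -!scalemxAl !mxtraceZ trA trpq => e; apply/eqP.
  have : 2%:R * (r - 2)%:R * c == 0.
    rewrite -subN; last by lia.
    suff -> : 2%:R * (r%:R - 2%:R) * c = c * r%:R - (r%:R - 4) * - c by rewrite e subrr.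
    by ring.
  rewrite !mulf_eq0 !(negbTE (nz _ _)) //; last by lia.
  by rewrite subn_gt0 leq_subr andbT; lia.
have A0 : A = 0.
  move: eA => /eqP; rewrite c0 scale0r subN 1?ltnW // scaler_eq0.
  by rewrite (negbTE (nz _ _)) ?subn_gt0 ?r4 ?leq_subr // => /eqP.
have nz2 : r%:R - 2 != 0 :> F by rewrite subN ?nz; lia.
have cancel2 (a : 'M[F]_n) : r%:R *: a = 2%:R *: a -> a = 0.
  by move=> /eqP; rewrite -subr_eq0 -scalerBl scaler_eq0 (negbTE nz2) => /eqP.
move: contracted; rewrite c0 scale0r addr0 => ew.
have l0 : p *m q *m w = 0.
  apply: cancel2; have := congr1 (fun M => p *m q *m M) ew.
  rewrite /= -!scalemxAr mulmxDr !mulmxA -/A A0 add0r => ->.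
  by rewrite !(pqpr, pqp).
have r0 : w *m q *m p = 0.
  apply: cancel2; have := congr1 (fun M => M *m q *m p) ew.
  rewrite /= -!scalemxAl !mulmxDl -/A A0 addr0 => ->.
  by rewrite pqpr.
move: ew; rewrite l0 r0 addr0 scaler0 => /eqP.
have nzr : r%:R != 0 :> F by apply: nz; rewrite leqnn andbT; apply: leq_ltn_trans r4.
by rewrite scaler_eq0 (negbTE nzr) => /eqP.
Qed.

Lemma mxrank_mxsub m n m' n' (f : 'I_m' -> 'I_m) (g : 'I_n' -> 'I_n) (A : 'M[F]_(m, n)) :
  (\rank (mxsub f g A) <= \rank A)%N.
Proof.
have -> : mxsub f g A = rowsub f (colsub g A) by apply/matrixP => i j; rewrite !mxE.
apply: leq_trans (mxrankS (rowsub_sub _ _)) _.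
rewrite -mxrank_tr -[leqRHS]mxrank_tr.
have -> : (colsub g A)^T = rowsub g A^T by apply/matrixP => i j; rewrite !mxE.
exact: mxrankS (rowsub_sub _ _).
Qed.

Lemma mxrank_minor m n (A : 'M[F]_(m, n)) :
  exists (f : 'I_(\rank A) -> 'I_m) (g : 'I_(\rank A) -> 'I_n),
    \det (mxsub f g A) != 0.
Proof.
pose B := rowsub (maxrankfun A) A.
have fB : row_full B^T by rewrite /row_full mxrank_tr; exact: maxrowsub_free.
exists (maxrankfun A), (fullrankfun fB).
have := fullrowsub_unit fB; rewrite -unitmx_tr unitmxE unitfE.
congr (is_true (\det _ != 0)).
by apply/matrixP => i j; rewrite !mxE.
Qed.

End LinearAlgebra.

(** A minor that survives under [f] is nonzero, so it survives under the
    injective [g]. *)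
Lemma mxrank_map_le (A : comNzRingType) (F E : fieldType)
    (f : {rmorphism A -> F}) (g : {rmorphism A -> E}) m n (M : 'M[A]_(m, n)) :
  injective g -> (\rank (map_mx f M) <= \rank (map_mx g M))%N.
Proof.
move=> g_inj; have [h [l]] := mxrank_minor (map_mx f M).
rewrite -map_mxsub det_map_mx => det0.
apply: leq_trans (mxrank_mxsub h l _); rewrite -map_mxsub mxrank_unit //.
rewrite unitmxE det_map_mx unitfE -(rmorph0 g) (inj_eq g_inj).
by apply: contraNneq det0 => ->; rewrite rmorph0.
Qed.

(** * Multiplication by a bivector *)

Section Bivector.
Variables (K : fieldType) (n : nat).
Implicit Types (P Q R W : multivector K n) (i j k l : 'I_n) (S : {set 'I_n}).

(** The full skew matrix of the coefficients of a bivector.  Two contractions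
    give every entry its sign, so that identities need no case distinction on
    the order of the indices. *)
Definition bv_entry P i j : {mpoly K[n]} := contract_l j (contract_l i P) set0.

Lemma wedge_set0 P Q : wedge P Q set0 = P set0 * Q set0.
Proof.
rewrite ffunE (big_pred1 set0) => [|A]; last by rewrite subset0.
by rewrite setD0 shuffle_signE big1 ?mul1r // => a; rewrite inE.
Qed.

Lemma bv_entryC P i j : bv_entry P i j = - bv_entry P j i.
Proof. by rewrite /bv_entry contract_l_anticomm !ffunE. Qed.

Lemma bv_entry_lt P i j : (i < j)%N -> bv_entry P i j = P [set i; j].
Proof.
move=> ij; have nij : i != j by rewrite neq_ltn ij.
rewrite /bv_entry !ffunE !inE orbF setU0 (negbTE nij) shuffle_signE big1 ?mul1r => [|a _].
  by rewrite shuffle_signE !big_set1 ltnNge (ltnW ij) mul1r.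
by rewrite big1 // => b; rewrite inE.
Qed.

Lemma bv_entry_diag P i : bv_entry P i i = 0.
Proof. by rewrite /bv_entry !ffunE !inE setU0 eqxx mulr0. Qed.

Lemma bv_entry_eq0 P : mv_degree 2 P -> (forall i j, bv_entry P i j = 0) -> P = 0.
Proof.
move=> dP P0; apply/ffunP => S; rewrite [RHS]ffunE.
have [/cards2P[i [j [nij ->]]]|/dP //] := boolP (#|S| == 2).
move: nij; rewrite neq_ltn => /orP[ij|ji]; first by rewrite -bv_entry_lt // P0.
by rewrite setUC -bv_entry_lt // P0.
Qed.

(** The left-hand side is the coefficient of the 4-vector [wedge W P], obtained
    from four contractions by the Leibniz rule.  Repeated indices are allowed,
    so that the relation can be summed over all values of two of them. *)
Lemma bv_entry_wedge W P i j k l : mv_degree 2 W -> mv_degree 2 P -> wedge W P = 0 ->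
  bv_entry W i j * bv_entry P k l - bv_entry W i k * bv_entry P j l
  + bv_entry W i l * bv_entry P j k + bv_entry W j k * bv_entry P i l
  - bv_entry W j l * bv_entry P i k + bv_entry W k l * bv_entry P i j = 0.
Proof.
move=> dW dP WP0.
have c1 a Q : mv_degree 2 Q -> mv_degree 1 (contract_l a Q).
  exact: mv_degree_contract_l.
have c0 a Q : mv_degree 1 Q -> mv_degree 0 (contract_l a Q).
  exact: mv_degree_contract_l.
have contract2 a Q R : mv_degree 2 Q -> contract_l a (wedge Q R)
    = wedge (contract_l a Q) R + wedge Q (contract_l a R).
  by move=> dQ; rewrite (contract_l_wedge _ _ dQ) -signr_odd scale1r.
have contract1 a Q R : mv_degree 1 Q -> contract_l a (wedge Q R)
    = wedge (contract_l a Q) R - wedge Q (contract_l a R).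
  by move=> dQ; rewrite (contract_l_wedge _ _ dQ) expr1 scaleN1r.
have contract0 a Q R : mv_degree 0 Q -> contract_l a (wedge Q R)
    = wedge Q (contract_l a R).
  by move=> dQ; rewrite (contract_l_wedge _ _ dQ) contract_l0 // wedge0l add0r scale1r.
have e02 Q R : mv_degree 0 Q ->
    bv_entry (wedge Q R) i j = Q set0 * bv_entry R i j.
  by move=> dQ; rewrite /bv_entry !contract0 // wedge_set0.
have e11 Q R : mv_degree 1 Q -> mv_degree 1 R -> bv_entry (wedge Q R) i j
    = contract_l i Q set0 * contract_l j R set0
      - contract_l j Q set0 * contract_l i R set0.
  move=> dQ dR; rewrite /bv_entry contract1 // raddfB /=.
  rewrite contract0 ?contract1 ?(contract_l0 j (c0 i R dR)) ?wedge0r ?subr0; try exact: c0.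
    by rewrite -!wedge_set0; move: (wedge _ _) (wedge _ _) => x y; rewrite !ffunE.
  exact: dQ.
have e20 Q R : mv_degree 2 Q -> mv_degree 0 R ->
    bv_entry (wedge Q R) i j = bv_entry Q i j * R set0.
  move=> dQ dR; rewrite /bv_entry contract2 // (contract_l0 i dR) wedge0r addr0.
  by rewrite contract1 ?(contract_l0 j dR) ?wedge0r ?subr0 ?wedge_set0 //; apply: c1.
have bvD Q R : bv_entry (Q + R) i j = bv_entry Q i j + bv_entry R i j.
  by rewrite /bv_entry !raddfD ffunE.
have bvN Q : bv_entry (- Q) i j = - bv_entry Q i j.
  by rewrite /bv_entry !raddfN ffunE.
have : bv_entry (contract_l l (contract_l k (wedge W P))) i j = 0.
  by rewrite WP0 /bv_entry !raddf0 ffunE.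
rewrite contract2 // raddfD /= (contract1 l) ?(contract2 l) //; last exact: c1.
have dcW a := c1 a _ dW; have dcP a := c1 a _ dP.
rewrite !(bvD, bvN) (e02 _ _ (c0 l _ (dcW k))) (e20 _ _ dW (c0 l _ (dcP k))).
rewrite !(e11 _ _ (dcW _) (dcP _)).
rewrite -!/(bv_entry _ _ _) => <-.
rewrite (bv_entryC W i k) (bv_entryC W i l) (bv_entryC W j k) (bv_entryC W j l).
rewrite (bv_entryC P j l) (bv_entryC P j k) (bv_entryC P i k) (bv_entryC P i l).
by ring.
Qed.

End Bivector.

Section BivectorRank.
Variables (K : fieldType) (n : nat).
Hypothesis char0 : [pchar K] =i pred0.
Implicit Types (P W : multivector K n).

Lemma bivector_mxE P x :
  bivector_mx P x = map_mx (meval x) (\matrix_(i, j) bv_entry P i j).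
Proof.
apply/matrixP => i j; rewrite !mxE.
case: ltngtP => [ij|ji|/val_inj ->]; first by rewrite bv_entry_lt.
  by rewrite bv_entryC bv_entry_lt // setUC mevalN.
by rewrite bv_entry_diag meval0.
Qed.

Lemma max_rankP P r : (r < max_rank P)%N -> exists x, (r < \rank (bivector_mx P x))%N.
Proof.
move=> rP; apply: boolp.contrapT => no; move: rP; apply/negP; rewrite -leqNgt.
apply/bigmax_leqP => s /boolp.asboolP[x rx]; rewrite leqNgt; apply/negP => rs.
by apply: no; exists x; rewrite rx.
Qed.

(** Over the fraction field of the polynomial ring, the rank of [P] is its
    generic rank, which is at least the rank at any point. *)
Lemma wedge_bivector_inj W P : mv_degree 2 W -> mv_degree 2 P ->
  (4 < max_rank P)%N -> wedge W P = 0 -> W = 0.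
Proof.
move=> dW dP /max_rankP[x rk4] WP0.
pose w := map_mx (@tofrac {mpoly K[n]}) (\matrix_(i, j) bv_entry W i j).
pose p := map_mx (@tofrac {mpoly K[n]}) (\matrix_(i, j) bv_entry P i j).
have tofrac_inj : injective (@tofrac {mpoly K[n]}).
  by move=> a b /eqP; rewrite tofrac_eq => /eqP.
suff w0 : w = 0.
  apply: bv_entry_eq0 => // i j; apply/eqP; rewrite -tofrac_eq0.
  by have /matrixP/(_ i j) := w0; rewrite !mxE => ->.
have skew Q : (map_mx (@tofrac {mpoly K[n]}) (\matrix_(i, j) bv_entry Q i j))^T
    = - map_mx (@tofrac {mpoly K[n]}) (\matrix_(i, j) bv_entry Q i j).
  by apply/matrixP => i j; rewrite !mxE bv_entryC rmorphN.
apply: (@skew_wedge_inj _ _ w p); rewrite /w /p ?skew //.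
- move=> m /andP[m0 _].
  rewrite -(rmorph_nat (@tofrac _)) tofrac_eq0 -mpolyC_nat mpolyC_eq0.
  by rewrite ((pcharf0P K).1 char0) -lt0n.
- by apply: leq_trans rk4 _; rewrite bivector_mxE; apply: mxrank_map_le.
- move=> i j k l; rewrite !mxE -!rmorphM -!(rmorphB, rmorphD).
  by rewrite bv_entry_wedge ?rmorph0.
Qed.

End BivectorRank.

(** * The vanishing of the bracket *)

Lemma pchar_scalars (R : realType) (k : scalar_kind) : [pchar (scalars R k)] =i pred0.
Proof. by case: k; exact: Num.Theory.pchar_num. Qed.

Theorem theorem3p2 (R : realType) (k : scalar_kind)
    (s : vectType (scalars R k)) (br : s -> s -> s)
    (n : nat) (e : n.-tuple s)
    (X : multivector (scalars R k) n) (q : {mpoly (scalars R k)[n]}) :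
  is_lie_bracket br -> semisimple br -> basis_of fullv e ->
  (6 <= generic_coadjoint_orbit_dim br e)%N ->
  quadratic_vector_field X -> q \is 2.-homog ->
  let pi1 := lie_poisson br e in
  let pi := schouten X pi1 in
  schouten pi pi = wedge (hamiltonian pi1 q) pi1 *+ 2 ->
  schouten pi (hamiltonian pi1 q) = 0.
Proof.
move=> br_lie _ e_basis rank6 [dX _] _ pi1 pi pi_sq; have char0 := pchar_scalars R k.
have dpi1 : mv_degree 2 pi1 := lie_poisson_degree br e.
have dpi : mv_degree 2 pi := mv_degree_schouten dX dpi1.
have dY : mv_degree 1 (hamiltonian pi1 q).
  exact: mv_degree_schouten dpi1 (@mv_degree_fun _ _ q).
have pi1_pi : schouten pi1 pi = 0.
  rewrite /pi (schouten_antisym dX dpi1) -signr_odd scale1r raddfN /=.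
  by rewrite schouten_poisson_sqr ?oppr0 //; apply: schouten_lie_poisson.
have pi_pi1 : schouten pi pi1 = 0.
  by rewrite (schouten_antisym dpi dpi1) pi1_pi scaler0 oppr0.
apply: (wedge_bivector_inj char0 (mv_degree_schouten dpi dY) dpi1 (ltnW rank6)).
apply: (lmod_mulrn_inj char0 (m := 1)); have := schouten_bivector_self_self char0 dpi.
by rewrite pi_sq raddfMn /= (schouten_wedge _ dpi dY) pi_pi1 wedge0r scaler0 addr0.
Qed.
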